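(* Suppose the homogeneous non-Riemannian $(\alpha_1,\alpha_2)$ metric $F=\sqrt{L(\alpha_1^2,\alpha_2^2)}$, defined using the $G$-invariant Riemannian metric $\alpha$, is naturally reductive on $G/H$ with respect to the reductive decomposition $\mathfrak g=\mathfrak h+\mathfrak m$. Then $\alpha$ is also naturally reductive for the same decomposition, i.e. $\langle y,[y,x]_{\mathfrak m}\rangle=0$ for all $x,y\in\mathfrak m$, where $\langle\cdot,\cdot\rangle$ is the inner product on $\mathfrak m$ given by $\alpha$.
   Context: **Finsler metrics.** A Minkowski norm on a finite dimensional real vector space $\mathbf V$ is a continuous function $F:\mathbf V\to[0,+\infty)$ that is positive and smooth on $\mathbf V\setminus\{0\}$, satisfies $F(\lambda y)=\lambda F(y)$ for $\lambda\ge 0$, and for which $g_y(u,v)=\frac12\frac{\partial^2}{\partial s\partial t}F^2(y+su+tv)|_{s=t=0}$ is an inner product for every $y\neq0$. Its Cartan tensor is $C_y(u,v,w)=\frac12\frac{d}{dt}|_{t=0}g_{y+tw}(u,v)$. A Finsler metric on $M$ is a continuous function $F:TM\to[0,+\infty)$, smooth on $TM\setminus0$, restricting to a Minkowski norm on each $T_xM$; it is Riemannian if $g_y$ at each $x$ is independent of $y\in T_xM\setminus\{0\}$. **Homogeneous setting.** $M=G/H$ where $G$ is a Lie subgroup of the isometry group $I(M,F)$ acting transitively and $H$ is the isotropy subgroup at $o=eH$; $\mathfrak g=\mathrm{Lie}(G)$, $\mathfrak h=\mathrm{Lie}(H)$; a reductive decomposition is $\mathfrak g=\mathfrak h+\mathfrak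 m$ with $\mathfrak m$ an $\mathrm{Ad}(H)$-invariant complement, identified with $T_o(G/H)$; $v_{\mathfrak m}$ is the $\mathfrak m$-component of $v\in\mathfrak g$. A homogeneous metric is identified with its $\mathrm{Ad}(H)$-invariant restriction to $\mathfrak m$. A homogeneous $(\alpha_1,\alpha_2)$ metric on $G/H$ is given on $\mathfrak m$ by an $\mathrm{Ad}(H)$-invariant Euclidean norm $\alpha=\langle\cdot,\cdot\rangle^{1/2}$, an $\mathrm{Ad}(H)$-invariant $\alpha$-orthogonal decomposition $\mathfrak m=\mathfrak m_1+\mathfrak m_2$ with $\dim\mathfrak m_i>0$, and a function $L:[0,+\infty)\times[0,+\infty)\to[0,+\infty)$, positively 1-homogeneous and smooth away from the origin, such that $F(y)=\sqrt{L(\alpha_1(y)^2,\alpha_2(y)^2)}$ is a Minkowski norm, where $\alpha_i(y)=\alpha(y_i)$ for $y=y_1+y_2$, $y_i\in\mathfrak m_i$. The norm $\alpha$ on $\mathfrak m$ determines a $G$-invariant Riemannian metric on $G/H$, also denoted $\alpha$. **Natural reductiveness.** $F$ is naturally reductive for $G/H$ and $\mathfrak g=\mathfrak h+\mathfrak m$ if $$g_y([w,u]_{\mathfrak m},v)+g_y([w,v]_{\mathfrak m},u)+2C_y([w,y]_{\mathfrak m},u,v)=0\quad\text{for all } y\in\mathfrak m\setminus\{0\},\ u,v,w\in\mathfrak m.$$ *)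

(* Defs.v *)
From HB Require Import structures.
From mathcomp Require Import all_boot all_order all_algebra.
From mathcomp Require Import all_classical all_reals all_analysis.
Set Implicit Arguments.
Unset Strict Implicit.
Unset Printing Implicit Defensive.
Import Order.TTheory GRing.Theory Num.Theory.
Import numFieldNormedType.Exports.
Local Open Scope classical_set_scope.
Local Open Scope ring_scope.

(* [U] is meant to be open.  On an open set, f is C^(k+1) iff it is (Frechet)
   differentiable and all its directional derivatives are C^k. *)
Fixpoint Ck_on (R : realType) (V W : normedModType R) (k : nat)
    (U : set V) (f : V -> W) : Prop :=
  match k with
  | 0 => forall x, U x -> {for x, continuous f}
  | j.+1 => (forall x, U x -> differentiable f x) /\
            (forall v : V, Ck_on j U ('D_v f))
  end.

Definition smooth_on (R : realType) (V W : normedModType R)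
    (U : set V) (f : V -> W) : Prop := forall k, Ck_on k U f.

(* A vectType has no topology of its own: calculus on V is done in the linear
   coordinates given by a basis. *)
Definition of_coord (R : realType) (V : vectType R)
    (x : 'rV[R]_(\dim {:V})) : V :=
  \sum_(i < \dim {:V}) x ord0 i *: (vbasis {:V})`_i.

#[short(type="topGroupType")]
HB.structure Definition TopGroup := {G of Group G & Topological G}.

Record chart (R : realType) (M : topologicalType) (n : nat) := Chart {
  chart_dom : set M;
  chart_map :> M -> 'rV[R]_n;
  chart_inv : 'rV[R]_n -> M
}.

Definition chart_im (R : realType) (M : topologicalType) (n : nat)
  (c : chart R M n) : set 'rV[R]_n := c @` chart_dom c.

Record is_chart (R : realType) (M : topologicalType) (n : nat)
    (c : chart R M n) : Prop := {
  chart_dom_open : open (chart_dom c);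
  chart_im_open : open (chart_im c);
  chart_mapK : forall p, chart_dom c p -> chart_inv c (c p) = p;
  chart_map_cont : forall p, chart_dom c p -> {for p, continuous c};
  chart_inv_cont :
    forall x, chart_im c x -> {for x, continuous (chart_inv c)}
}.

Record is_smooth_atlas (R : realType) (M : topologicalType) (n : nat)
    (A : set (chart R M n)) : Prop := {
  atlas_chart : forall c, A c -> is_chart c;
  atlas_cover : forall p, exists2 c, A c & chart_dom c p;
  atlas_compat : forall a b, A a -> A b ->
    smooth_on (a @` (chart_dom a `&` chart_dom b)) (b \o chart_inv a)
}.

Record is_lie_group (R : realType) (G : topGroupType) (n : nat)
    (A : set (chart R G n)) : Prop := {
  lie_group_hausdorff : hausdorff_space G;
  lie_group_countable : @second_countable G;
  lie_group_atlas : is_smooth_atlas A;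
  lie_group_mul_cont : continuous (fun p : G * G => (p.1 * p.2)%g);
  lie_group_inv_cont : continuous (fun g : G => (g^-1)%g);
  lie_group_mul_smooth : forall a b c, A a -> A b -> A c ->
    smooth_on
      [set p : 'rV[R]_n * 'rV[R]_n | [/\ chart_im a p.1, chart_im b p.2 &
         chart_dom c (chart_inv a p.1 * chart_inv b p.2)%g]]
      (fun p => c (chart_inv a p.1 * chart_inv b p.2)%g);
  lie_group_inv_smooth : forall a b, A a -> A b ->
    smooth_on
      [set x : 'rV[R]_n | chart_im a x /\ chart_dom b ((chart_inv a x)^-1)%g]
      (fun x => b ((chart_inv a x)^-1)%g)
}.

Definition smooth_fun (R : realType) (M : topologicalType) (n : nat)
    (A : set (chart R M n)) (f : M -> R) : Prop :=
  forall c, A c -> smooth_on (chart_im c) (f \o chart_inv c : _ -> R^o).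

(* Vector fields are derivations of the algebra of smooth functions; only the
   values of an operator on smooth functions are meaningful. *)
Record left_inv_field (R : realType) (G : topGroupType) (n : nat)
    (A : set (chart R G n)) (X : (G -> R) -> (G -> R)) : Prop := {
  field_smooth : forall f, smooth_fun A f -> smooth_fun A (X f);
  field_linear : forall (k : R) f g, smooth_fun A f -> smooth_fun A g ->
    X (fun a => k * f a + g a) = (fun a => k * X f a + X g a);
  field_leibniz : forall f g, smooth_fun A f -> smooth_fun A g ->
    X (fun a => f a * g a) = (fun a => X f a * g a + f a * X g a);
  field_left_inv : forall (b : G) f, smooth_fun A f ->
    X (fun a => f (b * a)%g) = (fun a => X f (b * a)%g)
}.

(* [X] identifies the vector space [g] with the left-invariant vector fields
   on [G], [br] being the commutator of vector fields. *)
Record is_lie_algebra_of (R : realType) (G : topGroupType) (n : nat)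
    (A : set (chart R G n)) (g : vectType R) (br : g -> g -> g)
    (X : g -> (G -> R) -> (G -> R)) : Prop := {
  lie_field : forall x, left_inv_field A (X x);
  lie_linear : forall (k : R) x y f, smooth_fun A f ->
    X (k *: x + y) f = (fun a => k * X x f a + X y f a);
  lie_inj : forall x y, (forall f, smooth_fun A f -> X x f = X y f) -> x = y;
  lie_surj : forall Y, left_inv_field A Y ->
    exists x, forall f, smooth_fun A f -> X x f = Y f;
  lie_bracket : forall x y f, smooth_fun A f ->
    X (br x y) f = (fun a => X x (X y f) a - X y (X x f) a)
}.

(* [c] is the one-parameter subgroup t |-> exp(tx), i.e. the integral curve
   through 1 of the left-invariant field x. *)
Definition is_exp_curve (R : realType) (G : topGroupType) (n : nat)
    (A : set (chart R G n)) (g : vectType R) (X : g -> (G -> R) -> (G -> R))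
    (x : g) (c : R -> G) : Prop :=
  c 0 = 1%g /\ forall f, smooth_fun A f ->
    forall t : R, is_derive (t : R^o) 1 (f \o c : R^o -> R^o) (X x f (c t)).

Record closed_subgroup (G : topGroupType) (H : set G) : Prop := {
  subgroup_closed : closed H;
  subgroup1 : H 1%g;
  subgroupM : forall a b, H a -> H b -> H (a * b)%g;
  subgroupV : forall a, H a -> H (a^-1)%g
}.

Definition is_lie_subalgebra_of (R : realType) (G : topGroupType) (n : nat)
    (A : set (chart R G n)) (g : vectType R) (X : g -> (G -> R) -> (G -> R))
    (H : set G) (h : {vspace g}) : Prop :=
  forall x, x \in h <->
    exists2 c : R -> G, is_exp_curve A X x c & forall t, H (c t).

(* Ad(a) x is the tangent vector at 1 whose derivative of f is the one of
   f(a _ a^-1) along x. *)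
Definition Ad (R : realType) (G : topGroupType) (n : nat)
    (A : set (chart R G n)) (g : vectType R) (X : g -> (G -> R) -> (G -> R))
    (a : G) (x : g) : g :=
  xget 0 [set y | forall f, smooth_fun A f ->
    X y f 1%g = X x (fun b => f (a * b * a^-1)%g) 1%g].

(* The action of G on G/H is effective: this is what makes G a group of
   isometries of G/H, for any G-invariant metric. *)
Definition effective (G : topGroupType) (H : set G) : Prop :=
  forall a : G, (forall b, H (b * a * b^-1)%g) -> a = 1%g.

Record reductive_decomposition (R : realType) (G : topGroupType) (n : nat)
    (A : set (chart R G n)) (g : vectType R) (X : g -> (G -> R) -> (G -> R))
    (H : set G) (h m : {vspace g}) : Prop := {
  reductive_sum : (h + m)%VS = fullv;
  reductive_direct : (h :&: m)%VS = 0%VS;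
  reductive_Ad : forall a x, H a -> x \in m -> Ad A X a x \in m
}.

Definition m_part (R : realType) (g : vectType R) (h m : {vspace g})
    (v : g) : subvs_of m :=
  vsproj m (daddv_pi m h v).

Definition m_bracket (R : realType) (g : vectType R) (br : g -> g -> g)
    (h m : {vspace g}) (u v : subvs_of m) : subvs_of m :=
  m_part h m (br (vsval u) (vsval v)).

Definition isotropy (R : realType) (G : topGroupType) (n : nat)
    (A : set (chart R G n)) (g : vectType R) (X : g -> (G -> R) -> (G -> R))
    (m : {vspace g}) (a : G) (v : subvs_of m) : subvs_of m :=
  vsproj m (Ad A X a (vsval v)).

Record is_inner_product (R : realType) (V : vectType R)
    (b : V -> V -> R) : Prop := {
  inner_linear : forall (k : R) u v w, b (k *: u + v) w = k * b u w + b v w;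
  inner_sym : forall u v, b u v = b v u;
  inner_pos : forall u, u != 0 -> 0 < b u u
}.

Definition fundamental_tensor (R : realType) (V : vectType R) (F : V -> R)
    (y u v : V) : R :=
  2^-1 * derive1 (fun s : R =>
    derive1 (fun t : R => F (y + s *: u + t *: v) ^+ 2) 0) 0.

Definition cartan_tensor (R : realType) (V : vectType R) (F : V -> R)
    (y u v w : V) : R :=
  2^-1 * derive1 (fun t : R => fundamental_tensor F (y + t *: w) u v) 0.

Record is_minkowski_norm (R : realType) (V : vectType R)
    (F : V -> R) : Prop := {
  mink_ge0 : forall y, 0 <= F y;
  mink_cont : continuous (F \o @of_coord R V : _ -> R^o);
  mink_pos : forall y, y != 0 -> 0 < F y;
  mink_smooth : smooth_on [set x | @of_coord R V x != 0]
                          (F \o @of_coord R V : _ -> R^o);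
  mink_homo : forall (k : R) y, 0 <= k -> F (k *: y) = k * F y;
  mink_inner : forall y, y != 0 -> is_inner_product (fundamental_tensor F y)
}.

Definition is_riemannian_norm (R : realType) (V : vectType R)
    (F : V -> R) : Prop :=
  forall y z u v, y != 0 -> z != 0 ->
    fundamental_tensor F y u v = fundamental_tensor F z u v.

Definition ip_norm (R : realType) (V : vectType R) (ip : V -> V -> R)
    (v : V) : R := Num.sqrt (ip v v).

Record alpha12_data (R : realType) (G : topGroupType) (n : nat)
    (A : set (chart R G n)) (g : vectType R) (X : g -> (G -> R) -> (G -> R))
    (H : set G) (m : {vspace g}) (ip : subvs_of m -> subvs_of m -> R)
    (m1 m2 : {vspace subvs_of m}) : Prop := {
  alpha_inner : is_inner_product ip;
  alpha_inv : forall a u v, H a ->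
    ip (isotropy A X a u) (isotropy A X a v) = ip u v;
  alpha_sum : (m1 + m2)%VS = fullv;
  alpha_orth : forall u v, u \in m1 -> v \in m2 -> ip u v = 0;
  alpha_inv1 : forall a u, H a -> u \in m1 -> isotropy A X a u \in m1;
  alpha_inv2 : forall a u, H a -> u \in m2 -> isotropy A X a u \in m2;
  alpha_dim1 : (0 < \dim m1)%N;
  alpha_dim2 : (0 < \dim m2)%N
}.

(* L is only meaningful on the closed quadrant; smoothness at its boundary
   points means that L extends smoothly to an open neighbourhood. *)
Record is_L_function (R : realType) (L : R -> R -> R) : Prop := {
  L_ge0 : forall a b, 0 <= a -> 0 <= b -> 0 <= L a b;
  L_homo : forall k a b, 0 < k -> 0 <= a -> 0 <= b ->
    L (k * a) (k * b) = k * L a b;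
  L_smooth : exists (U : set (R^o * R^o)) (L' : R^o * R^o -> R^o),
    [/\ open U,
        forall a b, 0 <= a -> 0 <= b -> (a, b) != (0, 0) ->
          U (a, b) /\ L' (a, b) = L a b
      & smooth_on U L']
}.

Definition alpha12_norm (R : realType) (V : vectType R) (ip : V -> V -> R)
    (m1 m2 : {vspace V}) (L : R -> R -> R) (y : V) : R :=
  Num.sqrt (L (ip_norm ip (daddv_pi m1 m2 y) ^+ 2)
              (ip_norm ip (daddv_pi m2 m1 y) ^+ 2)).

Definition naturally_reductive (R : realType) (g : vectType R)
    (br : g -> g -> g) (h m : {vspace g}) (F : subvs_of m -> R) : Prop :=
  forall y u v w : subvs_of m, y != 0 ->
    fundamental_tensor F y (m_bracket br h w u) v
    + fundamental_tensor F y (m_bracket br h w v) u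
    + 2 * cartan_tensor F y (m_bracket br h w y) u v = 0.

(* Main.v *)
From HB Require Import structures.
Require Import Defs.
From mathcomp Require Import all_boot all_order all_algebra.
From mathcomp Require Import all_classical all_reals all_analysis.
From mathcomp Require Import ring lra.
Import Order.TTheory GRing.Theory Num.Theory.
Import numFieldNormedType.Exports.
Local Open Scope classical_set_scope.
Local Open Scope ring_scope.
Set Implicit Arguments.
Unset Strict Implicit.
Unset Printing Implicit Defensive.

(** Put [E = F^2] and, for [w] in [m], let [T u] be the [m]-part of [[w, u]].
    Natural reductiveness at [u = v = y] reads [dE_y (T y) = 0], by the
    homogeneity of [E].  With [p], [q] the partial derivatives of [L] at
    [(|y1|^2, |y2|^2)] this is [p <y1, T y> + q <y2, T y> = 0].  At [y = y1] or
    [y = y2] Euler's identity makes the surviving coefficient positive, so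
    [<y1, T y1> = <y2, T y2> = 0]; then [p <y1, T y2> + q <y2, T y1> = 0], where
    rescaling [y1] and [y2] moves the arguments of [p] and [q] over the whole
    open quadrant.  If the constants [<y1, T y2>] and [<y2, T y1>] did not
    cancel, [L] would solve a first-order linear equation which, together with
    Euler's, forces it to be linear, and [F] would be Riemannian.  Hence
    [<y, T y> = 0]. *)

(** * Calculus along lines, in linear coordinates *)

Lemma is_derive_line (R : realType) (W : normedModType R) (f : W -> R^o)
    (x v : W) (t : R) : derivable f (x + t *: v) v ->
  is_derive t 1 (fun s : R => f (x + s *: v) : R) ('D_v f (x + t *: v)).
Proof.
move=> df.
have E : (fun h : R => h^-1 *: (((fun s : R => f (x + s *: v) : R) \o shift t)
    (h *: 1) - f (x + t *: v))) =
  (fun h : R => h^-1 *: ((f \o shift (x + t *: v)) (h *: v) - f (x + t *: v))).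
  apply/funext => h /=; congr (_ *: (f _ - _)).
  by rewrite [h *: 1]mulr1 scalerDl addrCA.
by apply: DeriveDef; rewrite /derivable /derive E.
Qed.

Lemma of_coordP (R : realType) (V : vectType R) (v : V) :
  exists x, of_coord x = v.
Proof.
exists (\row_i coord (vbasis {:V}) i v).
rewrite [RHS](coord_vbasis (memvf v)) /of_coord.
by apply: eq_bigr => i _; rewrite mxE.
Qed.

Lemma of_coordD (R : realType) (V : vectType R)
    (x v : 'rV[R]_(\dim {:V})) (t : R) :
  of_coord (x + t *: v) = of_coord x + t *: of_coord v :> V.
Proof.
rewrite /of_coord scaler_sumr -big_split; apply: eq_bigr => i _ /=.
by rewrite !mxE scalerDl scalerA.
Qed.

(** The line meets 0 for at most one parameter [s0], and [s0] is nonzero because [y] is; so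
    [|s| < |s0|] is enough. *)
Lemma line_neq0 (R : realType) (V : lmodType R) (y u : V) :
  y != 0 -> \forall s \near (0 : R), y + s *: u != 0.
Proof.
move=> y0.
have [[s0 s0y]|H] := pselect (exists s0 : R, y + s0 *: u = 0); last first.
  by near=> s; apply/eqP => e; apply: H; exists s.
have s00 : 0 < `|s0|.
  rewrite normr_gt0; apply: contra_neq y0 => e.
  by rewrite e scale0r addr0 in s0y.
near=> s; apply/eqP => e.
have /eqP : (s - s0) *: u = 0.
  rewrite scalerBl; have -> : s *: u = - y.
    by apply/eqP; rewrite -addr_eq0 addrC e.
  by apply/eqP; rewrite -opprD s0y oppr0.
rewrite scaler_eq0 subr_eq0 => /orP[/eqP es|/eqP u0].
  have : `|s| < `|s0| by near: s; exact: (@nbhs0_lt R R^o).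
  by rewrite es ltxx.
by move: y0; rewrite -s0y u0 scaler0 addr0 eqxx.
Unshelve. all: by end_near. Qed.

(** * Derivatives of the square of a Minkowski norm along lines *)

Section MinkowskiNorm.
Variables (R : realType) (V : vectType R) (F : V -> R).
Hypothesis hF : is_minkowski_norm F.

Let f : 'rV[R]_(\dim {:V}) -> R^o := F \o @of_coord R V.

Lemma mink_sq_is_derive x v t : of_coord (x + t *: v) != 0 :> V ->
  is_derive t 1 (fun s : R => F (of_coord x + s *: of_coord v) ^+ 2)
    (2 * f (x + t *: v) * 'D_v f (x + t *: v)).
Proof.
move=> x0; have [df _] := mink_smooth hF 1.
have := @is_derive_line _ _ f x v t (diff_derivable (df _ x0)).
move=> /(is_deriveX 1.+1).
under [fun s : R => F _ ^+ 2]funext do rewrite -of_coordD.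
rewrite /= expr1.
by [].
Qed.

Lemma mink_sq_derivable y v : y != 0 ->
  derivable (fun t : R => F (y + t *: v) ^+ 2) 0 1.
Proof.
have [x <-] := of_coordP y; have [w <-] := of_coordP v => x0.
have [] // := @mink_sq_is_derive x w 0.
by rewrite scale0r addr0.
Qed.

Lemma mink_sq_derivable2 y u v : y != 0 ->
  derivable (fun s : R =>
    derive1 (fun t : R => F (y + s *: u + t *: v) ^+ 2) 0) 0 1.
Proof.
have [x <-] := of_coordP y; have [w <-] := of_coordP v.
have [z <-] := of_coordP u => x0.
have [df dDf] := mink_smooth hF 2.
have [dDfw _] := dDf w.
have : derivable
    (fun s : R => 2 * f (x + s *: z) * 'D_w f (x + s *: z) : R) 0 1.
  have x0' : [set x | of_coord x != 0 :> V] (x + 0 *: z).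
    by rewrite /= scale0r addr0.
  have [H1 _] := @is_derive_line _ _ f x z 0 (diff_derivable (df _ x0')).
  have [H2 _] :=
    @is_derive_line _ _ ('D_w f) x z 0 (diff_derivable (dDfw _ x0')).
  apply: derivableM => //; apply: derivableM => //.
(* The product formula for the inner derivative holds only where the base point is nonzero, hence
   for [s] near 0. *)
apply: near_eq_derivable.
near=> s; rewrite derive1E.
have s0 : of_coord (x + s *: z + 0 *: w) != 0 :> V.
  rewrite scale0r addr0 of_coordD; near: s.
  exact: line_neq0.
have [_] := mink_sq_is_derive s0.
by rewrite of_coordD scale0r addr0 => ->.
Unshelve. all: by end_near. Qed.

End MinkowskiNorm.

(** * Rescaled variables and quadratic functions *)

Lemma derive1_scale (R : realType) (g : R -> R) (k : R) : derivable g 0 1 ->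
  derive1 (fun t => g (k * t)) 0 = k * derive1 g 0.
Proof.
move=> dg; have dk : is_derive (0 : R) 1 ( *%R k) k.
  have := @is_deriveZ _ _ R^o id k 0 1 1 _.
  by rewrite [k *: 1]mulr1; exact.
rewrite -[X in derive1 X](_ : g \o *%R k = _) // derive1_comp; last 2 first.
- by have [] := dk.
- by rewrite mulr0.
by rewrite mulr0 [in LHS]mulrC [X in X * _]derive1E; have [_ ->] := dk.
Qed.

(** One shape for all the test curves below: squared lengths along a line, rays [x + t x], and
    [t^2]. *)
Lemma is_derive_quadratic0 (R : realType) (a b c : R) :
  is_derive (0 : R) 1 (fun t : R => a + t * b + t ^+ 2 * c) b.
Proof.
have -> : (fun t : R => a + t * b + t ^+ 2 * c) =
    horner (Poly [:: a; b; c]).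
  by apply/funext => t; rewrite horner_Poly /=; ring.
apply: is_derive_eq; rewrite -horner_evalE; set p := Poly _.
by rewrite horner_evalE horner_coef0 coef_deriv coef_Poly.
Qed.

Lemma derive1_quadratic0 (R : realType) (a b c : R) :
  derive1 (fun t : R => a + t * b + t ^+ 2 * c) 0 = b.
Proof. by rewrite derive1E; have [_ ->] := is_derive_quadratic0 a b c. Qed.

Section Quadratic.
Variables (R : realType) (V : vectType R) (b : V -> V -> R) (F : V -> R).
Hypothesis b_linear :
  forall (k : R) u v w, b (k *: u + v) w = k * b u w + b v w.
Hypothesis b_sym : forall u v, b u v = b v u.
Hypothesis sqF : forall y, F y ^+ 2 = b y y.

Lemma sym_form_line y v t :
  b (y + t *: v) (y + t *: v) = b y y + t * (2 * b y v) + t ^+ 2 * b v v.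
Proof.
rewrite [y + _]addrC b_linear !(b_sym _ (t *: v + y)) !b_linear (b_sym v y).
ring.
Qed.

(** Serves twice: for [alpha] itself, and for [F] when [L] is linear. *)
Lemma fundamental_tensor_quadratic y u v : fundamental_tensor F y u v = b u v.
Proof.
rewrite /fundamental_tensor.
have -> : (fun s : R => derive1 (fun t : R => F (y + s *: u + t *: v) ^+ 2) 0)
    = (fun s : R => 2 * b y v + s * (2 * b u v) + s ^+ 2 * 0).
  apply/funext => s; under [X in derive1 X]funext do rewrite sqF sym_form_line.
  by rewrite derive1_quadratic0 [y + _]addrC b_linear; ring.
by rewrite derive1_quadratic0 mulKf // pnatr_eq0.
Qed.

End Quadratic.

(** * Consequences of homogeneity for the fundamental and Cartan tensors *)

Section Homogeneity.
Variables (R : realType) (V : vectType R) (F : V -> R).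
Hypothesis hF : is_minkowski_norm F.

Let dE y v := derive1 (fun t : R => F (y + t *: v) ^+ 2) 0.

(** Since [k y + t v = k (y + (t / k) v)] and [F^2] is 2-homogeneous, the factor is [k^2 / k]. *)
Lemma mink_sq_derive1Z k y v : 0 < k -> y != 0 -> dE (k *: y) v = k * dE y v.
Proof.
move=> k0 y0; rewrite /dE.
have -> : (fun t : R => F (k *: y + t *: v) ^+ 2) =
    (fun t : R => k ^+ 2 * F (y + (k^-1 * t) *: v) ^+ 2).
  apply/funext => t; rewrite -exprMn.
  rewrite -(mink_homo hF _ (ltW k0)) scalerDr scalerA mulrA divff ?mul1r //.
  exact: lt0r_neq0.
have dF := mink_sq_derivable hF y0.
have dk : derivable (fun t : R => F (y + (k^-1 * t) *: v) ^+ 2) 0 1.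
  apply/derivable1_diffP.
  apply: (@differentiable_comp _ _ _ _ ( *%R k^-1)
    (fun t : R => F (y + t *: v) ^+ 2)).
    exact: (@differentiableZ _ _ R^o id).
  by rewrite mulr0; apply/derivable1_diffP.
rewrite derive1Ml //.
rewrite (@derive1_scale _ (fun t : R => F (y + t *: v) ^+ 2) k^-1) //.
rewrite mulrA expr2 mulfK //.
exact: lt0r_neq0.
Qed.

(** The same rescaling one order higher: the factor is now [k / k]. *)
Lemma fundamental_tensorZ k y u v : 0 < k -> y != 0 ->
  fundamental_tensor F (k *: y) u v = fundamental_tensor F y u v.
Proof.
move=> k0 y0; have k0' := lt0r_neq0 k0.
pose g s := dE (y + s *: u) v.
have dg : derivable g 0 1 by exact: mink_sq_derivable2.
rewrite /fundamental_tensor; congr (_ * _).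
transitivity (derive1 (fun s : R => k * g (k^-1 * s)) 0).
  rewrite !derive1E; apply: near_eq_derive; near=> s.
  rewrite /= -mink_sq_derive1Z //; last first.
    by rewrite mulrC -scalerA; near: s; exact: line_neq0.
  by rewrite scalerDr scalerA mulVKf.
have dk : derivable (fun s : R => g (k^-1 * s)) 0 1.
  apply/derivable1_diffP.
  apply: (@differentiable_comp _ _ _ _ ( *%R k^-1) g).
    exact: (@differentiableZ _ _ R^o id).
  by rewrite mulr0; apply/derivable1_diffP.
by rewrite derive1Ml // derive1_scale // mulVKf.
Unshelve. all: by end_near. Qed.

Lemma fundamental_tensor_radial y v : y != 0 ->
  fundamental_tensor F y y v = 2^-1 * dE y v.
Proof.
move=> y0; rewrite /fundamental_tensor; congr (_ * _).
(* By 1-homogeneity [dE (y + s y) v = (1 + s) dE y v] as soon as [1 + s > 0], an affine function of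
   [s] with slope [dE y v]. *)
rewrite -[RHS](@derive1_quadratic0 _ (dE y v) _ 0) !derive1E.
apply: near_eq_derive; near=> s.
rewrite -/(dE (y + s *: y) v) -{1}[y]scale1r -scalerDl mink_sq_derive1Z //.
  ring.
rewrite -ltrBlDl sub0r.
have : `|s| < 1 by near: s; exact: (@nbhs0_lt R R^o).
by rewrite ltr_norml => /andP[].
Unshelve. all: by end_near. Qed.

(** The Cartan term differentiates [g] in the direction [y], along which [g] is constant by
    0-homogeneity; the other two terms are each half of [dE y w]. *)
Lemma mink_infinitesimal_isometry y w : y != 0 ->
  fundamental_tensor F y w y + fundamental_tensor F y w y
    + 2 * cartan_tensor F y w y y = 0 ->
  dE y w = 0.
Proof.
move=> y0.
rewrite (inner_sym (mink_inner hF y0)) fundamental_tensor_radial //.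
rewrite (_ : cartan_tensor F y w y y = 0).
  by rewrite mulr0 addr0 => <-; field.
rewrite /cartan_tensor -[RHS](mulr0 2^-1); congr (_ * _).
rewrite -[RHS](derive1_cst (fundamental_tensor F y w y) (0 : R)) !derive1E.
apply: near_eq_derive; near=> s.
rewrite -{1}[y]scale1r -scalerDl fundamental_tensorZ //.
rewrite -ltrBlDl sub0r.
have : `|s| < 1 by near: s; exact: (@nbhs0_lt R R^o).
by rewrite ltr_norml => /andP[].
Unshelve. all: by end_near. Qed.

End Homogeneity.

(** * The gradient of [L] on the closed quadrant *)

Lemma derivable_dnbhs_eq (R : realType) (f g : R -> R) (x : R) :
  derivable f x 1 -> derivable g x 1 ->
  (\forall t \near x^', f t = g t) -> f x = g x.
Proof.
move=> /derivable1_diffP/differentiable_continuous df.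
move=> /derivable1_diffP/differentiable_continuous dg fg.
have cf : f @ x^' --> f x by apply: cvg_within_filter df.
have cg : f @ x^' --> g x.
  apply: (@cvg_trans _ (g @ x^')); last by apply: cvg_within_filter dg.
  by apply: near_eq_cvg; near=> t; apply/esym; near: t.
exact: (cvg_unique _ cf cg).
Unshelve. all: by end_near. Qed.

(* One-sided at the boundary of the quadrant: only curves staying in the
   quadrant near [t0] are tested. *)
Definition quadrant_gradient (R : realType) (L p q : R -> R -> R) : Prop :=
  forall (al be : R -> R) (t0 al' be' : R),
    is_derive t0 1 al al' -> is_derive t0 1 be be' ->
    (\forall t \near t0, 0 <= al t /\ 0 <= be t) ->
    (al t0, be t0) != (0, 0) ->
    is_derive t0 1 (fun t => L (al t) (be t))
      (al' * p (al t0) (be t0) + be' * q (al t0) (be t0)).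

Section QuadrantFunction.
Variables (R : realType) (L : R -> R -> R).
Hypothesis hL : is_L_function L.

(** The partial derivatives of a smooth extension [L'] of [L] serve: a curve that stays in the
    quadrant and avoids the origin sees no difference between [L] and [L']. *)
Lemma quadrant_gradient_exists : exists p q, quadrant_gradient L p q.
Proof.
have [U [L' [_ LU sL']]] := L_smooth hL.
exists (fun a b => 'd L' (a, b) (1, 0)), (fun a b => 'd L' (a, b) (0, 1)).
move=> al be t0 al' be' [dal <-] [dbe <-] ge0 n0.
have /derivable1_diffP Dal := dal; have /derivable1_diffP Dbe := dbe.
pose g t : R^o * R^o := (al t, be t).
have Dg : differentiable g t0 by exact: differentiable_pair.
have [a0 b0] := nbhs_singleton ge0.
have [dL' _] := sL' 1%N.
have DL : differentiable L' (g t0) by apply: dL'; have [] := LU _ _ a0 b0 n0.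
have DLg : differentiable (L' \o g) t0 by exact: differentiable_comp.
have near0 : \forall t \near t0, (L' \o g) t = L (al t) (be t).
  have gn0 : \forall t \near t0, (al t, be t) != (0, 0).
    have cal := differentiable_continuous Dal.
    have cbe := differentiable_continuous Dbe.
    have [al0|be0] : al t0 != 0 \/ be t0 != 0.
      by move: n0; rewrite xpair_eqE negb_and => /orP.
      near=> t; rewrite xpair_eqE negb_and; apply/orP; left; near: t.
      exact: (cvgr_neq0 _ cal al0).
    near=> t; rewrite xpair_eqE negb_and; apply/orP; right; near: t.
    exact: (cvgr_neq0 _ cbe be0).
  near=> t; have [] : 0 <= al t /\ 0 <= be t by near: t.
  move=> at0 bt0; have [] // := LU _ _ at0 bt0.
  by near: t.
apply: near_eq_is_derive near0 _.
apply: DeriveDef; first exact/derivable1_diffP.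
rewrite deriveE // diff_comp // /comp.
rewrite diff_pair // -(deriveE (1 : R) Dal) -(deriveE (1 : R) Dbe).
have -> : ('D_1 al t0, 'D_1 be t0) =
    'D_1 al t0 *: ((1, 0) : R^o * R^o) + 'D_1 be t0 *: ((0, 1) : R^o * R^o).
  rewrite [RHS]surjective_pairing /=.
  by rewrite ![_ *: 1]mulr1 ![_ *: 0]mulr0 addr0 add0r.
by rewrite linearD !linearZ.
Unshelve. all: by end_near. Qed.

Lemma L_00 : L 0 0 = 0.
Proof.
(* Homogeneity is assumed for positive factors only; the factor 2 gives [L 0 0 = 2 L 0 0]. *)
have := L_homo hL (a := 0) (b := 0) (ltr0n R 2) (lexx _) (lexx _).
by rewrite mulr0; lra.
Qed.

Variables p q : R -> R -> R.
Hypothesis hpq : quadrant_gradient L p q.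

(** Differentiate [L ((1 + t) a) ((1 + t) b) = (1 + t) L a b] at [t = 0]. The ray remains in the
    closed quadrant, so boundary points are covered. *)
Lemma L_euler a b : 0 <= a -> 0 <= b -> (a, b) != (0, 0) ->
  a * p a b + b * q a b = L a b.
Proof.
move=> a0 b0 ab0.
have Dl (x : R) : is_derive (0 : R) 1 (fun t : R => x + t * x + t ^+ 2 * 0) x.
  exact: is_derive_quadratic0.
have near0 : \forall t \near (0 : R), 0 < 1 + t.
  near=> t; rewrite -ltrBlDl sub0r.
  have : `|t| < 1 by near: t; exact: (@nbhs0_lt R R^o).
  by rewrite ltr_norml => /andP[].
have E (x t : R) : x + t * x + t ^+ 2 * 0 = (1 + t) * x by ring.
have := hpq (Dl a) (Dl b).
rewrite !E !(addr0, mul1r) => /(_ _ ab0).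
case.
  near=> t; rewrite !E; have t0 : 0 < 1 + t by near: t.
  by rewrite !mulr_ge0 // ltW.
move=> _ <-.
have [_ <-] := Dl (L a b).
apply: near_eq_derive; near=> t; rewrite !E L_homo //.
by near: t.
Unshelve. all: by end_near. Qed.

Hypothesis L_pos : forall a b, 0 < a -> 0 < b -> 0 < L a b.

(* On the line [a = 1] the two relations [c p + d q = 0] and [p + s q = L]
   say that [L 1 s / (d - c s)] has zero derivative. *)
Lemma L_linear c d : (c, d) != (0, 0) ->
  (forall a b, 0 < a -> 0 < b -> c * p a b + d * q a b = 0) ->
  exists k l, forall a b, 0 <= a -> 0 <= b -> L a b = k * a + l * b.
Proof.
move=> cd0 hcd.
(* If [d = c s], the relation at [(1, s)] becomes [c (p + s q) = c L 1 s = 0]; positivity of [L]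
   gives [c = 0], and then [d = 0]. *)
have n0 s : 0 < s -> d - c * s != 0.
  move=> s0; apply: contra_neq cd0 => ds.
  have {}ds : d = c * s by apply/eqP; rewrite -subr_eq0 ds.
  have := hcd 1 s ltr01 s0.
  have n1 : (1, s) != (0, 0) :> R * R by rewrite xpair_eqE oner_eq0.
  have := L_euler ler01 (ltW s0) n1; rewrite mul1r => e.
  rewrite ds -mulrA -mulrDr e => /eqP.
  rewrite mulf_eq0 (gt_eqF (L_pos ltr01 s0)) orbF => /eqP c0.
  by rewrite c0 mul0r.
(* The substitution [s = expR t] turns the half-line into all of [R], where a zero derivative forces
   a constant. *)
pose h (t : R) := L 1 (expR t) / (d - c * expR t).
have hcst x y : h x = h y.
  apply: is_derive_0_is_cst => t.
  have e0 := expR_gt0 t.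
  have n1 : (1, expR t) != (0, 0) :> R * R by rewrite xpair_eqE oner_eq0.
  have dL : is_derive t 1 (fun t => L 1 (expR t)) (expR t * q 1 (expR t)).
    rewrite -[_ * q _ _]add0r -[X in X + _](mul0r (p 1 (expR t))).
    apply: (hpq (is_derive_cst (1 : R) t 1) (is_derive_expR t)) n1.
    by near=> z; rewrite /cst ler01 expR_ge0.
  have dD : is_derive t 1 (fun t => d - c * expR t) (- (c * expR t)).
    rewrite -[- _]add0r.
    exact: (is_deriveB (is_derive_cst (d : R) t 1)
                       (is_deriveZ c (is_derive_expR t))).
  have dV := @is_deriveV R (fun t => d - c * expR t) t _ 1 (n0 _ e0) dD.
  apply: (is_derive_eq (is_deriveM dL dV)).
  have := L_euler ler01 (expR_ge0 t) n1; have := hcd 1 (expR t) ltr01 e0.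
  have := n0 _ e0; rewrite /GRing.scale /=.
  move: (expR t) (L _ _) (p _ _) (q _ _) => s l p' q' ds0 e1 <-.
  (* In the quotient rule, replacing [L] by [p + s q] cancels the terms in [c s q]. *)
  transitivity (s * (c * p' + d * q') / (d - c * s) ^+ 2); first by field.
  by rewrite e1 mulr0 mul0r.
have L1 s : 0 < s -> L 1 s = h 0 * (d - c * s).
  move=> s0; rewrite (hcst 0 (ln s)) /h lnK ?posrE // divfK //.
  exact: n0.
(* Read off from [L a b = a L 1 (b / a)] and [L 1 s = h 0 (d - c s)]. *)
exists (h 0 * d), (- (h 0 * c)).
have Lint a b : 0 < a -> 0 < b -> L a b = h 0 * d * a + - (h 0 * c) * b.
  move=> a0 b0.
  have -> : L a b = a * L 1 (b / a).
    rewrite -L_homo ?ler01 ?divr_ge0 ?ltW // mulr1 mulrC divfK //.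
    exact: lt0r_neq0.
  rewrite L1 ?divr_gt0 //; field; exact: lt0r_neq0.
(* The boundary is reached along [t^2], which stays in the quadrant on both sides of [t = 0]. Both
   sides of the formula are derivable there, hence continuous, and they agree for [t] nonzero. *)
have dsq : is_derive (0 : R) 1 (fun t : R => 0 + t * 0 + t ^+ 2 * 1) 0.
  exact: is_derive_quadratic0.
have sqE (t : R) : 0 + t * 0 + t ^+ 2 * 1 = t ^+ 2 by ring.
have sq_gt0 : \forall t \near (0 : R)^', 0 < t ^+ 2.
  by near=> t; rewrite exprn_even_gt0 //=; near: t; exact: nbhs_dnbhs_neq.
have {}dsq : is_derive (0 : R) 1 (fun t : R => t ^+ 2) 0.
  by under [fun t : R => t ^+ 2]funext do rewrite -sqE.
have sq0 : (0 : R) ^+ 2 = 0 by rewrite expr0n.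
move=> a b; rewrite !le_eqVlt => /orP[/eqP<-|a0] /orP[/eqP<-|b0].
- by rewrite L_00; ring.
- have := derivable_dnbhs_eq (f := fun t => L (t ^+ 2) b)
    (g := fun t => h 0 * d * t ^+ 2 + - (h 0 * c) * b) (x := 0).
  rewrite sq0; apply.
  + have n1 : (0 ^+ 2, b) != (0, 0) :> R * R.
      by rewrite xpair_eqE (gt_eqF b0) andbF.
    have [] // := hpq dsq (is_derive_cst (b : R) (0 : R) 1) _ n1.
    by near=> t; rewrite sqr_ge0 ltW.
  + apply: derivableD => //; apply: derivableM => //.
  + by near=> t; apply: Lint => //; near: t.
- have := derivable_dnbhs_eq (f := fun t => L a (t ^+ 2))
    (g := fun t => h 0 * d * a + - (h 0 * c) * t ^+ 2) (x := 0).
  rewrite sq0; apply.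
  + have n1 : (a, 0 ^+ 2) != (0, 0) :> R * R.
      by rewrite xpair_eqE (gt_eqF a0).
    have [] // := hpq (is_derive_cst (a : R) (0 : R) 1) dsq _ n1.
    by near=> t; rewrite sqr_ge0 ltW.
  + apply: derivableD => //; apply: derivableM => //.
  + by near=> t; apply: Lint => //; near: t.
- exact: Lint.
Unshelve. all: by end_near. Qed.

End QuadrantFunction.

(** * Inner product algebra *)

Section InnerProduct.
Variables (R : realType) (V : vectType R) (ip : V -> V -> R).
Hypothesis hip : is_inner_product ip.

Lemma ipDl u v w : ip (u + v) w = ip u w + ip v w.
Proof. by rewrite -[u]scale1r (inner_linear hip) mul1r scale1r. Qed.

Lemma ip0l w : ip 0 w = 0.
Proof. by have := ipDl 0 0 w; rewrite addr0; lra. Qed.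

Lemma ipZl k u w : ip (k *: u) w = k * ip u w.
Proof. by rewrite -[k *: u]addr0 (inner_linear hip) ip0l addr0. Qed.

Lemma ipDr u v w : ip w (u + v) = ip w u + ip w v.
Proof. by rewrite !(inner_sym hip w) ipDl. Qed.

Lemma ip0r w : ip w 0 = 0.
Proof. by rewrite (inner_sym hip) ip0l. Qed.

Lemma ipZr k u w : ip w (k *: u) = k * ip w u.
Proof. by rewrite !(inner_sym hip w) ipZl. Qed.

Lemma ip_ge0 u : 0 <= ip u u.
Proof.
have [->|u0] := eqVneq u 0; first by rewrite ip0l.
exact/ltW/(inner_pos hip).
Qed.

Lemma sq_ip_norm u : ip_norm ip u ^+ 2 = ip u u.
Proof. by rewrite sqr_sqrtr // ip_ge0. Qed.

End InnerProduct.

(** * Skewness of [T] for the inner product of a non-Riemannian norm *)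

Section Alpha12.
Variables (R : realType) (V : vectType R) (ip : V -> V -> R).
Variables (m1 m2 : {vspace V}) (L : R -> R -> R) (T : {linear V -> V}).
Hypothesis hip : is_inner_product ip.
Hypothesis m12_full : (m1 + m2)%VS = fullv.
Hypothesis m12_orth : forall u v, u \in m1 -> v \in m2 -> ip u v = 0.
Hypothesis hL : is_L_function L.

Let F := alpha12_norm ip m1 m2 L.
Let pr1 := daddv_pi m1 m2.
Let pr2 := daddv_pi m2 m1.

Hypothesis hF : is_minkowski_norm F.
Hypothesis hnR : ~ is_riemannian_norm F.
Hypothesis hT : forall y, y != 0 ->
  derive1 (fun t : R => F (y + t *: T y) ^+ 2) 0 = 0.

Lemma m12_direct : (m1 :&: m2 = 0)%VS.
Proof.
apply/eqP; rewrite -subv0; apply/subvP => u /memv_capP[u1 u2].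
rewrite memv0; apply: contraT => u0.
by have := inner_pos hip u0; rewrite m12_orth // ltxx.
Qed.

Lemma m21_direct : (m2 :&: m1 = 0)%VS.
Proof. by rewrite capvC m12_direct. Qed.

Lemma pr12_add y : pr1 y + pr2 y = y.
Proof. by apply: daddv_pi_add; rewrite ?m12_direct // m12_full memvf. Qed.

Lemma pr1_mem y : pr1 y \in m1. Proof. exact: memv_pi. Qed.
Lemma pr2_mem y : pr2 y \in m2. Proof. exact: memv_pi. Qed.

Lemma pr1_id y : y \in m1 -> pr1 y = y.
Proof. exact/daddv_pi_id/m12_direct. Qed.

Lemma pr2_id y : y \in m2 -> pr2 y = y.
Proof. exact/daddv_pi_id/m21_direct. Qed.

Lemma pr1_m2 y : y \in m2 -> pr1 y = 0.
Proof.
move=> y2; have := pr12_add y; rewrite pr2_id // => /eqP.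
by rewrite -subr_eq0 addrK => /eqP.
Qed.

Lemma pr2_m1 y : y \in m1 -> pr2 y = 0.
Proof.
move=> y1; have := pr12_add y; rewrite pr1_id // => /eqP.
by rewrite -subr_eq0 addrC addKr => /eqP.
Qed.

Lemma pr1D u1 u2 : u1 \in m1 -> u2 \in m2 -> pr1 (u1 + u2) = u1.
Proof. by move=> h1 h2; rewrite linearD /= pr1_id // pr1_m2 // addr0. Qed.

Lemma pr2D u1 u2 : u1 \in m1 -> u2 \in m2 -> pr2 (u1 + u2) = u2.
Proof. by move=> h1 h2; rewrite linearD /= pr2_m1 // pr2_id // add0r. Qed.

Lemma ip_pr1 u w : u \in m1 -> ip u (pr1 w) = ip u w.
Proof.
move=> u1; rewrite -{2}[w]pr12_add (ipDr hip).
by rewrite (m12_orth u1 (pr2_mem w)) addr0.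
Qed.

Lemma ip_pr2 u w : u \in m2 -> ip u (pr2 w) = ip u w.
Proof.
move=> u2; rewrite -{2}[w]pr12_add (ipDr hip).
by rewrite (inner_sym hip u (pr1 w)) (m12_orth (pr1_mem w) u2) add0r.
Qed.

Lemma sq_alpha12 y : F y ^+ 2 = L (ip (pr1 y) (pr1 y)) (ip (pr2 y) (pr2 y)).
Proof.
rewrite /F /alpha12_norm !(sq_ip_norm hip) sqr_sqrtr //.
by apply: (L_ge0 hL); exact: ip_ge0.
Qed.

Lemma sq_alpha12_sum u1 u2 : u1 \in m1 -> u2 \in m2 ->
  F (u1 + u2) ^+ 2 = L (ip u1 u1) (ip u2 u2).
Proof.
by move=> h1 h2; rewrite sq_alpha12 pr1D // pr2D.
Qed.

Variables p q : R -> R -> R.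
Hypothesis hpq : quadrant_gradient L p q.

Lemma ip_pair_neq0 u1 u2 : u1 != 0 \/ u2 != 0 ->
  (ip u1 u1, ip u2 u2) != (0, 0) :> R * R.
Proof.
by case=> /(inner_pos hip) H; rewrite xpair_eqE (gt_eqF H) ?andbF.
Qed.

(** This is [hT] at [u1 + u2], expanded by the chain rule and divided by 2. *)
Lemma gradient_tangent u1 u2 : u1 \in m1 -> u2 \in m2 ->
  u1 != 0 \/ u2 != 0 ->
  ip u1 (T (u1 + u2)) * p (ip u1 u1) (ip u2 u2)
    + ip u2 (T (u1 + u2)) * q (ip u1 u1) (ip u2 u2) = 0.
Proof.
move=> h1 h2 n0; set w := T (u1 + u2).
have y0 : u1 + u2 != 0.
  case: n0; apply: contra_neq => e.
    by rewrite -(pr1D h1 h2) e linear0.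
  by rewrite -(pr2D h1 h2) e linear0.
have := hT y0; rewrite -/w.
have -> : (fun t : R => F (u1 + u2 + t *: w) ^+ 2) = (fun t : R =>
    L (ip u1 u1 + t * (2 * ip u1 w) + t ^+ 2 * ip (pr1 w) (pr1 w))
      (ip u2 u2 + t * (2 * ip u2 w) + t ^+ 2 * ip (pr2 w) (pr2 w))).
  apply/funext => t; rewrite sq_alpha12.
  rewrite linearD linearZ /= pr1D // linearD linearZ /= pr2D //.
  rewrite !(sym_form_line (inner_linear hip) (inner_sym hip)).
  by rewrite ip_pr1 // ip_pr2.
have D1 := is_derive_quadratic0 (ip u1 u1) (2 * ip u1 w) (ip (pr1 w) (pr1 w)).
have D2 := is_derive_quadratic0 (ip u2 u2) (2 * ip u2 w) (ip (pr2 w) (pr2 w)).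
have := hpq D1 D2; rewrite !(mul0r, expr0n, addr0).
move=> /(_ _ (ip_pair_neq0 n0)) [].
  (* Both arguments of [L] are squared lengths of components, so the curve never leaves the
     quadrant. *)
  near=> t; rewrite -(ip_pr1 w h1) -(ip_pr2 w h2).
  rewrite -!(sym_form_line (inner_linear hip) (inner_sym hip)).
  by split; exact: ip_ge0.
move=> _; rewrite derive1E => ->; lra.
Unshelve. all: by end_near. Qed.

(** With zero second component the tangency relation is [ip u (T u) * p = 0], and Euler's identity
    gives [|u|^2 p = F u ^+ 2 > 0], so [p] is nonzero. *)
Lemma T_skew1 u : u \in m1 -> ip u (T u) = 0.
Proof.
move=> u1; have [->|u0] := eqVneq u 0; first by rewrite (ip0l hip).
have n0 : u != 0 \/ (0 : V) != 0 by left.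
have := gradient_tangent u1 (mem0v m2) n0.
have := L_euler hL hpq (ip_ge0 hip _) (ip_ge0 hip _) (ip_pair_neq0 n0).
rewrite -(sq_alpha12_sum u1 (mem0v m2)) addr0 !(ip0l hip) !mul0r !addr0.
move=> e /eqP.
rewrite mulf_eq0 => /orP[/eqP //|/eqP p0].
have := mink_pos hF u0; move: e; rewrite p0 mulr0 => /esym/eqP.
by rewrite sqrf_eq0 => /eqP ->; rewrite ltxx.
Qed.

Lemma T_skew2 u : u \in m2 -> ip u (T u) = 0.
Proof.
move=> u2; have [->|u0] := eqVneq u 0; first by rewrite (ip0l hip).
have n0 : (0 : V) != 0 \/ u != 0 by right.
have := gradient_tangent (mem0v m1) u2 n0.
have := L_euler hL hpq (ip_ge0 hip _) (ip_ge0 hip _) (ip_pair_neq0 n0).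
rewrite -(sq_alpha12_sum (mem0v m1) u2) add0r !(ip0l hip) !mul0r !add0r.
move=> e /eqP.
rewrite mulf_eq0 => /orP[/eqP //|/eqP p0].
have := mink_pos hF u0; move: e; rewrite p0 mulr0 => /esym/eqP.
by rewrite sqrf_eq0 => /eqP ->; rewrite ltxx.
Qed.

(** [F^2] is then the quadratic form of [b], and the fundamental tensor is [b] at every point. *)
Lemma quadratic_alpha12 k l :
  (forall a b, 0 <= a -> 0 <= b -> L a b = k * a + l * b) ->
  is_riemannian_norm F.
Proof.
move=> Lkl.
pose b u v := k * ip (pr1 u) (pr1 v) + l * ip (pr2 u) (pr2 v).
have bl s u v w : b (s *: u + v) w = s * b u w + b v w.
  by rewrite /b !linearD !linearZ /= !(inner_linear hip); ring.
have bs u v : b u v = b v u.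
  by rewrite /b (inner_sym hip (pr1 u)) (inner_sym hip (pr2 u)).
have bF y : F y ^+ 2 = b y y by rewrite sq_alpha12 Lkl // ip_ge0.
by move=> y z u v _ _; rewrite !(fundamental_tensor_quadratic bl bs bF).
Qed.

Lemma T_skew_mixed u1 u2 : u1 \in m1 -> u2 \in m2 ->
  ip u1 (T u2) + ip u2 (T u1) = 0.
Proof.
move=> h1 h2; apply: contrapT => /eqP cd0; apply: hnR.
have cd0' : (ip u1 (T u2), ip u2 (T u1)) != (0, 0) :> R * R.
  by apply: contra_neq cd0 => -[-> ->]; rewrite addr0.
have u10 : u1 != 0.
  by apply: contra_neq cd0 => ->; rewrite linear0 (ip0l hip) (ip0r hip) addr0.
have u20 : u2 != 0.
  by apply: contra_neq cd0 => ->; rewrite linear0 (ip0l hip) (ip0r hip) addr0.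
have a0 := inner_pos hip u10; have b0 := inner_pos hip u20.
(* Every point of the open quadrant is a pair of squared lengths of multiples of [u1] and [u2]. *)
have scaled a b : 0 < a -> 0 < b -> exists s t : R,
  [/\ 0 < s, 0 < t, ip (s *: u1) (s *: u1) = a & ip (t *: u2) (t *: u2) = b].
  move=> ap bp; exists (Num.sqrt (a / ip u1 u1)), (Num.sqrt (b / ip u2 u2)).
  rewrite !(ipZl hip) !(ipZr hip) !mulrA -!expr2.
  rewrite !sqr_sqrtr ?divr_ge0 ?ip_ge0 ?ltW //.
  by rewrite !divfK ?lt0r_neq0 // !sqrtr_gt0 !divr_gt0.
have L_pos a b : 0 < a -> 0 < b -> 0 < L a b.
  move=> ap bp; have [s [t [s0 t0 <- <-]]] := scaled a b ap bp.
  rewrite -sq_alpha12_sum ?rpredZ // exprn_gt0 // (mink_pos hF) //.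
  apply: contra_neq u10 => e.
  have := pr1D (rpredZ s h1) (rpredZ t h2); rewrite e linear0 => /esym/eqP.
  by rewrite scaler_eq0 (gt_eqF s0) => /eqP.
have [|k [l Lkl]] := L_linear hL hpq L_pos cd0'; last first.
  exact: quadratic_alpha12 Lkl.
(* At [s u1 + t u2] the diagonal terms vanish by skewness on each summand, and both mixed terms
   carry the factor [s t], which cancels. *)
move=> a b ap bp; have [s [t [s0 t0 <- <-]]] := scaled a b ap bp.
have sn : s *: u1 != 0 \/ t *: u2 != 0.
  by left; rewrite scaler_eq0 (gt_eqF s0).
have := gradient_tangent (rpredZ s h1) (rpredZ t h2) sn.
rewrite linearD !linearZ /= !(ipDr hip) !(ipZr hip) !(ipZl hip).
rewrite T_skew1 // T_skew2 // !mulr0 add0r addr0 => e.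
have st0 : s * t != 0 by rewrite mulf_neq0 ?lt0r_neq0.
apply: (mulfI st0); rewrite mulr0 -[RHS]e; ring.
Qed.

Lemma T_skew y : ip y (T y) = 0.
Proof.
rewrite -{1 2}[y]pr12_add linearD !(ipDr hip) !(ipDl hip).
rewrite T_skew1 ?pr1_mem // T_skew2 ?pr2_mem // addr0 add0r addrC.
exact: T_skew_mixed (pr1_mem y) (pr2_mem y).
Qed.

End Alpha12.

(** * The Lie bracket and natural reductiveness *)

Section LieBracket.
Variables (R : realType) (G : topGroupType) (n : nat) (A : set (chart R G n)).
Variables (g : vectType R) (br : g -> g -> g) (X : g -> (G -> R) -> (G -> R)).
Hypothesis hg : is_lie_algebra_of A br X.

Lemma lie_fieldN x f : smooth_fun A f -> X (- x) f = (fun a => - X x f a).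
Proof.
move=> sf.
have X0 a : X 0 f a = 0.
  have := congr1 (@^~ a) (lie_linear hg 1 0 0 sf).
  by rewrite /= scale1r addr0; lra.
rewrite -[- x]addr0 -scaleN1r (lie_linear hg) //.
by apply/funext => a; rewrite X0 mulN1r addr0.
Qed.

(** The algebraic laws of [br] come from the commutator of vector fields, through the injectivity of
    [X]. *)
Lemma brC x y : br x y = - br y x.
Proof.
apply: (lie_inj hg) => f sf; rewrite lie_fieldN // !(lie_bracket hg) //.
by apply/funext => a; rewrite opprB.
Qed.

Lemma br_linear x : linear (br x).
Proof.
move=> k u v; apply: (lie_inj hg) => f sf.
(* Linearity of the field [x] is available on smooth functions only, and it is applied to [X u f]
   and [X v f]. *)
have sX z : smooth_fun A (X z f) by exact: field_smooth (lie_field hg z) _ sf.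
rewrite (lie_linear hg) // !(lie_bracket hg) // (lie_linear hg) //.
rewrite (field_linear (lie_field hg x)) // (lie_linear hg) //.
by apply/funext => a; ring.
Qed.

Lemma m_bracket_linear (h m : {vspace g}) (w : subvs_of m) :
  linear (m_bracket br h w).
Proof.
by move=> k u v; rewrite /m_bracket /m_part linearP br_linear !linearP.
Qed.

Lemma m_bracketC (h m : {vspace g}) (u v : subvs_of m) :
  m_bracket br h u v = - m_bracket br h v u.
Proof. by rewrite /m_bracket /m_part brC !linearN. Qed.

End LieBracket.

Lemma naturally_reductive_ip (R : realType) (g : vectType R)
    (br : g -> g -> g) (h m : {vspace g}) (ip : subvs_of m -> subvs_of m -> R) :
  is_inner_product ip ->
  (forall w, linear (m_bracket br h (m := m) w)) ->
  (forall w y : subvs_of m, ip y (m_bracket br h w y) = 0) ->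
  naturally_reductive br h (ip_norm ip).
Proof.
move=> hip lin_br skew y u v w _.
have ft := fundamental_tensor_quadratic (inner_linear hip) (inner_sym hip)
  (sq_ip_norm hip).
rewrite /cartan_tensor; under [X in derive1 X]funext do rewrite ft.
rewrite derive1_cst !mulr0 addr0 !ft -(inner_sym hip v) -(inner_sym hip u).
(* Polarisation: the fundamental tensor is constantly [ip], so the Cartan term is gone and the rest
   is the mixed part of [skew] at [u + v]. *)
have := skew w (u + v); rewrite -[u]scale1r lin_br !scale1r.
by rewrite (ipDl hip) !(ipDr hip) !skew; lra.
Qed.

Theorem corollary3p4 (R : realType)
    (G : topGroupType) (n : nat) (A : set (chart R G n))
    (g : vectType R) (br : g -> g -> g) (X : g -> (G -> R) -> (G -> R))
    (H : set G) (h m : {vspace g})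
    (ip : subvs_of m -> subvs_of m -> R)
    (m1 m2 : {vspace subvs_of m}) (L : R -> R -> R)
    (hG : is_lie_group A)
    (hg : is_lie_algebra_of A br X)
    (hH : closed_subgroup H)
    (heff : effective H)
    (hh : is_lie_subalgebra_of A X H h)
    (hm : reductive_decomposition A X H h m)
    (hip : alpha12_data A X H ip m1 m2)
    (hL : is_L_function L)
    (hF : is_minkowski_norm (alpha12_norm ip m1 m2 L))
    (hnR : ~ is_riemannian_norm (alpha12_norm ip m1 m2 L))
    (hnat : naturally_reductive br h (alpha12_norm ip m1 m2 L)) :
  naturally_reductive br h (ip_norm ip) /\
  (forall x y : subvs_of m, ip y (m_bracket br h y x) = 0).
Proof.
have ip_ip := alpha_inner hip.
have lin_br := m_bracket_linear hg h (m := m).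
have skew w y : ip y (m_bracket br h w y) = 0.
  have [p [q hpq]] := quadrant_gradient_exists hL.
  pose T : {linear subvs_of m -> subvs_of m} :=
    HB.pack (m_bracket br h w) (GRing.isLinear.Build _ _ _ _ _ (lin_br w)).
  apply: (T_skew (T := T) ip_ip (alpha_sum hip) (alpha_orth hip) hL hF hnR _
                 hpq).
  (* Natural reductiveness is used only with [u = v = y = z]. *)
  by move=> z z0; apply: (mink_infinitesimal_isometry hF z0); exact: hnat.
split; first exact: naturally_reductive_ip.
by move=> x y; rewrite (m_bracketC hg) -scaleN1r (ipZr ip_ip) skew mulr0.
Qed.
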